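(* Let $E$ and $F$ be Banach spaces with $E \neq \{0\}$. If $F$ has a complemented copy of $c_0$, then $\Pi_1(E,F)$ has a complemented copy of $c_0$.
   Context: For Banach spaces $E,F$, a bounded linear operator $T: E \to F$ is absolutely 1-summing if $\sum_{n=1}^\infty \|T x_n\| < \infty$ for every sequence $(x_n)_n$ in $E$ such that $\sum_{n=1}^\infty |x^*(x_n)| < \infty$ for each $x^* \in E^*$. $\Pi_1(E,F)$ denotes the Banach space of all absolutely 1-summing operators from $E$ to $F$ with the norm $\pi_1(T) = \inf\{\rho > 0 : \sum_{i=1}^n \|T x_i\| \le \rho \sup_{x^* \in B_{E^*}} \sum_{i=1}^n |x^*(x_i)| \text{ for all } n \in \mathbb{N} \text{ and all } x_1,\dots,x_n \in E\}$, where $B_{E^*}$ is the closed unit ball of $E^*$. A Banach space has a complemented copy of $c_0$ if it has a closed subspace that is linearly homeomorphic to $c_0$ and is the range of a bounded linear projection on the whole space. *)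

(* Defs.v *)
From HB Require Import structures.
From mathcomp Require Import all_boot all_order all_algebra.
From mathcomp Require Import all_classical all_reals all_analysis.
From mathcomp Require Import complex.

Set Implicit Arguments.
Unset Strict Implicit.
Unset Printing Implicit Defensive.

Import Order.TTheory GRing.Theory Num.Theory.
Import numFieldNormedType.Exports.

Local Open Scope classical_set_scope.
Local Open Scope ring_scope.

(* The scalar field of a Banach space is either R or R[i]. *)
Variant scalar_kind := RealScalars | ComplexScalars.

Definition scalars (R : realType) (k : scalar_kind) : numFieldType :=
  match k with
  | RealScalars => R
  | ComplexScalars => R[i]
  end.

Section scalars.
Context {R : realType} {k : scalar_kind}.
Local Notation K := (scalars R k).

Definition ofR : R -> K :=
  match k return R -> scalars R k with
  | RealScalars => id
  | ComplexScalars => fun r => r%:C%C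
  end.

Definition toR : K -> R :=
  match k return scalars R k -> R with
  | RealScalars => id
  | ComplexScalars => fun z => complex.Re z
  end.

Lemma ofRK : cancel ofR toR.
Proof. by rewrite /ofR /toR; case: k. Qed.

Lemma ofRD r s : ofR (r + s) = ofR r + ofR s.
Proof.
rewrite /ofR; case: k => //=; exact: (rmorphD (real_complex R)).
Qed.

Lemma ofRM r s : ofR (r * s) = ofR r * ofR s.
Proof.
rewrite /ofR; case: k => //=; exact: (rmorphM (real_complex R)).
Qed.

Lemma ofR0 : ofR 0 = 0.
Proof. by rewrite /ofR; case: k. Qed.

Lemma ofR1 : ofR 1 = 1.
Proof. by rewrite /ofR; case: k. Qed.

Lemma ler_ofR r s : (ofR r <= ofR s) = (r <= s).
Proof. by rewrite /ofR; case: k => //=; rewrite lecR. Qed.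

Lemma toRK (x : K) : 0 <= x -> ofR (toR x) = x.
Proof.
rewrite /ofR /toR; case: k x => //= -[a b]; rewrite lecE/= => /andP[/eqP-> _].
by [].
Qed.

End scalars.

Section rnorm.
Context {R : realType} {k : scalar_kind}.
Local Notation K := (scalars R k).
Context {V : normedModType K}.
Implicit Types x y : V.

(* The norm `|x| lives in K; [rnorm x] is the same number as an element of R. *)
Definition rnorm x : R := toR `|x|.

Lemma ofR_rnorm x : ofR (rnorm x) = `|x|.
Proof. exact: toRK. Qed.

Lemma rnorm_ge0 x : 0 <= rnorm x.
Proof. by rewrite -(@ler_ofR R k) ofR_rnorm ofR0. Qed.

Lemma rnorm0 : rnorm 0 = 0.
Proof. by rewrite /rnorm normr0 -ofR0 ofRK. Qed.

Lemma rnorm0_eq0 x : rnorm x = 0 -> x = 0.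
Proof. by move=> x0; apply/normr0_eq0; rewrite -ofR_rnorm x0 ofR0. Qed.

Lemma ler_rnormD x y : rnorm (x + y) <= rnorm x + rnorm y.
Proof. by rewrite -(@ler_ofR R k) ofRD !ofR_rnorm ler_normD. Qed.

End rnorm.

Lemma rnormZ (R : realType) (k : scalar_kind) (V : normedModType (scalars R k))
    (a : scalars R k) (x : V) :
  rnorm (a *: x) = rnorm (a : (scalars R k)^o) * rnorm x.
Proof.
apply: (can_inj (@ofRK R k)).
by rewrite ofRM !ofR_rnorm normrZ.
Qed.

Section operators.
Context {R : realType} {k : scalar_kind}.
Local Notation K := (scalars R k).
Implicit Types E F : normedModType K.

Definition bounded_linear E F (T : E -> F) : Prop :=
  linear T /\ exists M : R, forall x, rnorm (T x) <= M * rnorm x.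

Definition opnorm E F (T : E -> F) : R :=
  sup [set rnorm (T x) | x in [set x | rnorm x <= 1]].

Definition dual E : set (E -> K^o) := [set f | bounded_linear f].
Arguments dual : clear implicits.

Definition dual_ball E : set (E -> K^o) := dual E `&` [set f | opnorm f <= 1].
Arguments dual_ball : clear implicits.

Definition weakly_summable E (x : nat -> E) : Prop :=
  forall f, dual E f -> (\sum_(0 <= n <oo) (rnorm (f (x n)))%:E < +oo)%E.

Definition absolutely_summing E F (T : E -> F) : Prop :=
  bounded_linear T /\
  forall x : nat -> E, weakly_summable x ->
    (\sum_(0 <= n <oo) (rnorm (T (x n)))%:E < +oo)%E.

Definition weak_norm E (n : nat) (x : 'I_n -> E) : R :=
  sup [set \sum_(i < n) rnorm (f (x i)) | f in dual_ball E].

Definition pi1_bounds E F (T : E -> F) : set R :=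
  [set rho | 0 < rho /\ forall (n : nat) (x : 'I_n -> E),
     \sum_(i < n) rnorm (T (x i)) <= rho * weak_norm x].

Definition pi1 E F (T : E -> F) : R := inf (pi1_bounds T).

Lemma bounded_linear_pos E F (T : E -> F) : bounded_linear T ->
  exists2 M : R, 0 < M & forall x, rnorm (T x) <= M * rnorm x.
Proof.
move=> [_ [M TM]]; exists (Num.max M 1); first by rewrite lt_max ltr01 orbT.
move=> x; apply: (le_trans (TM x)); rewrite ler_wpM2r ?rnorm_ge0//.
by rewrite le_max lexx.
Qed.

Lemma linear0 E F (T : E -> F) : linear T -> T 0 = 0.
Proof.
move=> lT; have := lT 1 0 0; rewrite !scale1r addr0 => /eqP.
by rewrite -subr_eq subrr eq_sym => /eqP.
Qed.

Lemma linearZ' E F (T : E -> F) a x : linear T -> T (a *: x) = a *: T x.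
Proof. by move=> lT; have := lT a x 0; rewrite (linear0 lT) !addr0. Qed.

Lemma rnorm_ofR (r : R) : 0 <= r -> rnorm (ofR r : K^o) = r.
Proof.
move=> r0; rewrite /rnorm ger0_norm ?ofRK//.
by rewrite -(@ofR0 R k) ler_ofR.
Qed.

Lemma opnorm_ubound E F (T : E -> F) : bounded_linear T ->
  has_ubound [set rnorm (T x) | x in [set x : E | rnorm x <= 1]].
Proof.
move=> /bounded_linear_pos[M M0 TM]; exists M => _ [x /= x1 <-].
by rewrite (le_trans (TM x))// ler_piMr// ltW.
Qed.

Lemma le_opnorm E F (T : E -> F) x : bounded_linear T ->
  rnorm (T x) <= opnorm T * rnorm x.
Proof.
move=> bT; have [lT _] := bT.
have [x0|x0] := eqVneq (rnorm x) 0.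
  by rewrite (rnorm0_eq0 x0) (linear0 lT) !rnorm0 mulr0.
have xgt0 : 0 < rnorm x by rewrite lt_neqAle eq_sym x0 rnorm_ge0.
have xi0 : 0 <= (rnorm x)^-1 by rewrite invr_ge0 ltW.
rewrite -ler_pdivrMr// mulrC -[_^-1](@rnorm_ofR _ xi0) -rnormZ -linearZ'//.
apply: (ub_le_sup (opnorm_ubound bT)).
by eexists => //=; rewrite rnormZ rnorm_ofR// mulVf.
Qed.

Lemma opnorm_le E F (T : E -> F) (M : R) : 0 <= M ->
  (forall x, rnorm (T x) <= M * rnorm x) -> opnorm T <= M.
Proof.
move=> M0 TM; apply: ge_sup; first by exists (rnorm (T 0)), 0 => //=; rewrite rnorm0.
by move=> _ [x /= x1 <-]; rewrite (le_trans (TM x))// ler_piMr.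
Qed.

Lemma dual_ball_le E f (x : E) : dual_ball E f -> rnorm (f x) <= rnorm x.
Proof.
move=> [fd f1]; rewrite (le_trans (le_opnorm x fd))//.
by rewrite ler_piMl// rnorm_ge0.
Qed.

Lemma dual_ball0 E : dual_ball E (fun=> 0).
Proof.
split; last by apply: opnorm_le => // x; rewrite rnorm0 mul1r rnorm_ge0.
split; first by move=> a u v; rewrite scaler0 addr0.
by exists 0 => x; rewrite rnorm0 mul0r.
Qed.

Lemma weak_norm_ge E n (x : 'I_n -> E) f : dual_ball E f ->
  \sum_(i < n) rnorm (f (x i)) <= weak_norm x.
Proof.
move=> fE; have ub : has_ubound [set \sum_(i < n) rnorm (f (x i)) | f in dual_ball E].
  exists (\sum_(i < n) rnorm (x i)) => _ [g gE <-].
  by apply: ler_sum => i _; exact: dual_ball_le.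
by apply: (ub_le_sup ub); exists f.
Qed.

Lemma weak_norm_le E n (x : 'I_n -> E) : weak_norm x <= \sum_(i < n) rnorm (x i).
Proof.
apply: ge_sup.
  by exists (\sum_(i < n) rnorm (0 : K^o)), (fun=> 0) => //; exact: dual_ball0.
by move=> _ [g gE <-]; apply: ler_sum => i _; exact: dual_ball_le.
Qed.

Lemma weak_norm_ge0 E n (x : 'I_n -> E) : 0 <= weak_norm x.
Proof.
rewrite (le_trans _ (weak_norm_ge x (dual_ball0 E)))//.
by apply: sumr_ge0 => i _; exact: rnorm_ge0.
Qed.

Lemma dual_weak_norm E f : dual E f -> exists2 M : R, 0 < M &
  forall n (x : 'I_n -> E), \sum_(i < n) rnorm (f (x i)) <= M * weak_norm x.
Proof.
move=> df; have [M M0 fM] := bounded_linear_pos df; have [lf _] := df.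
exists M => // n x; rewrite -ler_pdivrMl// mulr_sumr.
pose g : E -> K^o := fun y => (ofR M^-1 : K) *: f y.
have Mi0 : 0 <= M^-1 by rewrite invr_ge0 ltW.
have gE y : rnorm (g y) = M^-1 * rnorm (f y) by rewrite rnormZ rnorm_ofR.
have g1 y : rnorm (g y) <= 1 * rnorm y by rewrite gE ler_pdivrMl// mul1r.
have gB : dual_ball E g.
  split; last exact: opnorm_le.
  split; last by exists 1.
  by move=> a u v; rewrite /g lf scalerDr !scalerA mulrC.
apply: le_trans (weak_norm_ge x gB).
by under [leRHS]eq_bigr do rewrite gE.
Qed.

Lemma block_series E (N : nat -> nat) (X : nat -> nat -> E)
    (e : nat -> nat * nat) (g : E -> R) :
  set_bij [set: nat] [set: nat * nat] e -> (forall z, 0 <= g z) -> g 0 = 0 ->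
  (\sum_(0 <= n <oo)
     (g (if ((e n).2 < N (e n).1)%N then X (e n).1 (e n).2 else 0))%:E =
   \sum_(0 <= m <oo) (\sum_(i < N m) g (X m i))%:E)%E.
Proof.
move=> eb g0 g00.
rewrite nneseries_esumT; last by move=> n; rewrite lee_fin.
pose G (p : nat * nat) := (g (if (p.2 < N p.1)%N then X p.1 p.2 else 0))%:E.
rewrite -(@reindex_esum R _ _ [set: nat] [set: nat * nat] e G eb).
have -> : [set: nat * nat] = [set: nat] `*`` (fun=> [set: nat]).
  by apply/seteqP; split.
rewrite -(@esum_esum R _ _ _ _ (fun m i => G (m, i))); last first.
  by move=> *; rewrite lee_fin.
rewrite nneseries_esumT; last by move=> n; rewrite lee_fin sumr_ge0.
apply: eq_esum => m _.
rewrite -sumEFin (@fsbig_ord _ _ _ _ (fun i => (g (X m i))%:E)) -esum_fset; last 2 first.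
- exact: finite_II.
- by move=> *; rewrite lee_fin.
rewrite [RHS]esum_mkcond; apply: eq_esum => i _; rewrite /G/=.
case: (boolP (i \in _)) => [/set_mem/= -> //|/negP iN].
case: ifPn => [iN'|_]; last by rewrite g00.
by exfalso; apply: iN; apply/mem_set.
Qed.

Lemma pi1_bounds_nonempty E F (T : E -> F) : absolutely_summing T -> pi1_bounds T !=set0.
Proof.
move=> [bT sT]; apply: contrapT => noB.
have lT := bT.1.
have big (r : R) : 0 < r -> exists n (x : 'I_n -> E),
    r * weak_norm x < \sum_(i < n) rnorm (T (x i)).
  move=> r0; apply: contrapT => nx; apply: noB; exists r; split => // n x.
  by rewrite leNgt; apply/negP => lx; apply: nx; exists n, x.
have block m : exists p : nat * (nat -> E),
    weak_norm (fun i : 'I_p.1 => p.2 i) <= 2^-1 ^+ m.+1 /\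
    1 <= \sum_(i < p.1) rnorm (T (p.2 i)).
  have m0 : 0 < (2 ^+ m.+1 : R) by rewrite exprn_gt0.
  have [n [x xb]] := big _ m0.
  set s := \sum_(i < n) _ in xb.
  have s0 : 0 < s.
    by rewrite (le_lt_trans _ xb)// mulr_ge0 ?weak_norm_ge0// ltW.
  have si0 : 0 <= s^-1 by rewrite invr_ge0 ltW.
  pose x' i : E := if insub i is Some j then (ofR s^-1 : K) *: x j else 0.
  have x'E (i : 'I_n) : x' i = (ofR s^-1 : K) *: x i by rewrite /x' valK.
  exists (n, x') => /=; split; last first.
    under eq_bigr do rewrite x'E linearZ'// rnormZ rnorm_ofR//.
    by rewrite -mulr_sumr mulVf// gt_eqF.
  rewrite /weak_norm; apply: ge_sup.
    by eexists; exists (fun=> 0); first exact: dual_ball0.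
  move=> _ [f fB <-]; have lf := fB.1.1.
  under eq_bigr do rewrite x'E (linearZ' _ _ lf) rnormZ rnorm_ofR//.
  rewrite -mulr_sumr ler_pdivrMl// exprVn ler_pdivlMr// mulrC.
  rewrite (le_trans _ (ltW xb))// ler_pM2l//; exact: weak_norm_ge.
have /choice[p pP] := block.
have /card_set_bijP[e eb] : ([set: nat] #= [set: nat * nat])%card.
  by rewrite card_eq_sym card_nat2.
pose N m := (p m).1; pose X m := (p m).2.
pose y n := if ((e n).2 < N (e n).1)%N then X (e n).1 (e n).2 else 0 : E.
have /sT : weakly_summable y.
  move=> f df; have lf := df.1; have [M M0 fM] := dual_weak_norm df.
  rewrite (block_series N X (g := fun z => rnorm (f z)) eb); last 2 first.
  - by move=> z; exact: rnorm_ge0.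
  - by rewrite (linear0 lf) rnorm0.
  apply: (@le_lt_trans _ _ (\sum_(0 <= m <oo) (M / (2 ^ m.+1)%:R)%:E)%E).
    apply: lee_nneseries => m _; first by
      rewrite lee_fin sumr_ge0// => *; exact: rnorm_ge0.
    rewrite lee_fin (le_trans (fM _ (fun i : 'I_(N m) => X m i)))//.
    by rewrite ler_pM2l// natrX -exprVn; case: (pP m).
  by rewrite (le_lt_trans (epsilon_trick0 _ (ltW M0)))// ltry.
rewrite (block_series N X (g := fun z => rnorm (T z)) eb); last 2 first.
- by move=> z; exact: rnorm_ge0.
- by rewrite (linear0 lT) rnorm0.
set S := (X in (X < _)%E -> _) => Soo.
have S0 m : (0 <= (\sum_(i < N m) rnorm (T (X m i)))%:E)%E.
  by rewrite lee_fin sumr_ge0// => *; exact: rnorm_ge0.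
have nS n : (n%:R%:E <= S)%E.
  apply: le_trans (nneseries_lim_ge n (fun m _ _ => S0 m)).
  rewrite sumEFin lee_fin -[n in n%:R]card_ord -sumr_const big_mkord.
  by apply: ler_sum => m _; case: (pP m).
have Sfin : S \is a fin_num by rewrite ge0_fin_numE//; exact: nS 0%N.
have := nS (Num.Def.trunc (fine S)).+1.
rewrite -[X in (_ <= X)%E](fineK Sfin) lee_fin leNgt.
by rewrite truncnS_gt.
Qed.

Lemma pi1_lb E F (T : E -> F) : has_lbound (pi1_bounds T).
Proof. by exists 0 => r [/ltW]. Qed.

Lemma pi1_ge0 E F (T : E -> F) : absolutely_summing T -> 0 <= pi1 T.
Proof.
by move=> /pi1_bounds_nonempty Tn; apply: lb_le_inf => // r [/ltW].
Qed.

Lemma pi1P E F (T : E -> F) n (x : 'I_n -> E) : absolutely_summing T ->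
  \sum_(i < n) rnorm (T (x i)) <= pi1 T * weak_norm x.
Proof.
move=> sT; have [w0|w0] := eqVneq (weak_norm x) 0.
  have [r [_ /(_ n x)]] := pi1_bounds_nonempty sT.
  by rewrite w0 !mulr0.
have wp : 0 < weak_norm x by rewrite lt_neqAle eq_sym w0 weak_norm_ge0.
rewrite -ler_pdivrMr//; apply: lb_le_inf; first exact: pi1_bounds_nonempty.
by move=> r -[_ rT]; rewrite ler_pdivrMr.
Qed.

Lemma pi1_le E F (T : E -> F) (r : R) : 0 <= r ->
  (forall n (x : 'I_n -> E), \sum_(i < n) rnorm (T (x i)) <= r * weak_norm x) ->
  pi1 T <= r.
Proof.
move=> r0 rT; apply/ler_addgt0Pr => e e0; apply: (ge_inf (pi1_lb T)).
split=> [|n x]; first by rewrite ltr_wpDl.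
by rewrite (le_trans (rT n x))// ler_wpM2r ?weak_norm_ge0// lerDl ltW.
Qed.

Lemma le_pi1 E F (T : E -> F) x : absolutely_summing T -> rnorm (T x) <= pi1 T * rnorm x.
Proof.
move=> sT; have := pi1P (fun _ : 'I_1 => x) sT; rewrite big_ord1 => /le_trans; apply.
rewrite ler_wpM2l ?pi1_ge0//.
by rewrite (le_trans (weak_norm_le _))// big_ord1.
Qed.

End operators.
Section c0.
Context (R : realType) (k : scalar_kind).
Local Notation K := (scalars R k).

Definition c0_pred : {pred nat -> K^o} :=
  [pred u | `[< u n @[n --> \oo] --> (0 : K^o) >]].

Record c0 := C0 { c0_val :> nat -> K^o; _ : c0_val \in c0_pred }.

HB.instance Definition _ := [isSub for c0_val].
HB.instance Definition _ := [Choice of c0 by <:].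

Lemma c0_submod_closed : submod_closed c0_pred.
Proof.
split.
  by apply: asboolT; exact: cvg_cst.
move=> a u v /asboolP u0 /asboolP v0; apply: asboolT.
have au : a *: u n @[n --> \oo] --> (a *: (0 : K^o)) by exact: cvgZl_tmp.
by rewrite scaler0 in au; have := cvgD au v0; rewrite addr0; apply.
Qed.

HB.instance Definition _ :=
  GRing.isSubmodClosed.Build K (nat -> K^o) c0_pred c0_submod_closed.
HB.instance Definition _ := [SubChoice_isSubLmodule of c0 by <:].

Definition c0_norm (u : c0) : R := sup (range (fun n => rnorm (c0_val u n))).

Lemma c0_ubound (u : c0) : has_ubound (range (fun n => rnorm (c0_val u n))).
Proof.
case: u => u /= /asboolP u0.
have /cvg_seq_bounded[m [mr uM]] : cvgn u by apply/cvg_ex; exists 0.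
pose M := `|m| + 1.
have {}uM n : `|u n| <= M.
  by apply: uM => //; rewrite (le_lt_trans (real_ler_norm mr))// ltrDl.
exists (toR M) => _ [n _ <-].
have Mn := uM n.
by rewrite -(@ler_ofR R k) ofR_rnorm toRK// (le_trans _ Mn).
Qed.

Lemma le_c0_norm (u : c0) n : rnorm (c0_val u n) <= c0_norm u.
Proof. by apply: (ub_le_sup (c0_ubound u)); exists n. Qed.

Lemma c0_norm_le (u : c0) (r : R) :
  (forall n, rnorm (c0_val u n) <= r) -> c0_norm u <= r.
Proof.
move=> ur; apply: ge_sup; first by exists (rnorm (c0_val u 0%N)), 0%N.
by move=> _ [n _ <-].
Qed.

Lemma c0_norm_ge0 (u : c0) : 0 <= c0_norm u.
Proof. exact: le_trans (rnorm_ge0 _) (le_c0_norm u 0%N). Qed.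

Fact c0_normD (u v : c0) :
  ofR (c0_norm (u + v)) <= ofR (c0_norm u) + ofR (c0_norm v) :> K.
Proof.
rewrite -ofRD ler_ofR; apply: c0_norm_le => n.
by rewrite (le_trans (ler_rnormD _ _))// lerD// le_c0_norm.
Qed.

Fact c0_normZ (a : K) (u : c0) : ofR (c0_norm (a *: u)) = `|a| * ofR (c0_norm u) :> K.
Proof.
rewrite -(ofR_rnorm (a : K^o)) -ofRM; congr ofR; apply/eqP; rewrite eq_le.
apply/andP; split.
  by apply: c0_norm_le => n; rewrite /= rnormZ ler_wpM2l ?rnorm_ge0// le_c0_norm.
have [->|a0] := eqVneq (rnorm (a : K^o)) 0; first by rewrite mul0r c0_norm_ge0.
have ap : 0 < rnorm (a : K^o) by rewrite lt_neqAle eq_sym a0 rnorm_ge0.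
rewrite -ler_pdivlMl//; apply: c0_norm_le => n.
by rewrite ler_pdivlMl// -rnormZ; exact: le_c0_norm (a *: u) n.
Qed.

Fact c0_norm0_eq0 (u : c0) : ofR (c0_norm u) = 0 :> K -> u = 0.
Proof.
rewrite -[X in _ = X]ofR0 => /(can_inj ofRK) u0; apply/val_inj/funext => n /=.
by apply/rnorm0_eq0/eqP; rewrite eq_le rnorm_ge0 andbT -u0 le_c0_norm.
Qed.

(* Norms of normed K-modules are K-valued, hence the embedding [ofR]; the
   topology of the instance is the one induced by the norm. *)
HB.instance Definition _ :=
  @Lmodule_isNormed.Build K c0 (fun u => ofR (c0_norm u))
    c0_normD c0_normZ c0_norm0_eq0.

End c0.

Section Pi1.
Context (R : realType) (k : scalar_kind).
Local Notation K := (scalars R k).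
Context (E F : normedModType K).

Definition Pi1_pred : {pred E -> F} := [pred T | `[< absolutely_summing T >]].

Record Pi1 := MkPi1 { Pi1_val :> E -> F; _ : Pi1_val \in Pi1_pred }.

HB.instance Definition _ := [isSub for Pi1_val].
HB.instance Definition _ := [Choice of Pi1 by <:].

Lemma Pi1_submod_closed : submod_closed Pi1_pred.
Proof.
split.
  apply: asboolT; split.
    split; first by move=> a u v; rewrite scaler0 addr0.
    by exists 0 => x; rewrite rnorm0 mul0r.
  move=> x _; rewrite eseries0 ?ltry// => i _ _; by rewrite rnorm0.
move=> a S T /asboolP[bS sS] /asboolP[bT sT]; apply: asboolT.
have STle x : rnorm ((a *: S + T) x) <= rnorm (a : K^o) * rnorm (S x) + rnorm (T x).
  by rewrite (le_trans (ler_rnormD _ _))// rnormZ.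
split.
  split.
    move=> b u v; rewrite !fctE /= bS.1 bT.1 !scalerDr addrACA; congr (_ + _ + _).
    by rewrite !scalerA mulrC.
  have [M M0 SM] := bounded_linear_pos bS; have [N N0 TN] := bounded_linear_pos bT.
  exists (rnorm (a : K^o) * M + N) => x; rewrite (le_trans (STle x))//.
  by rewrite mulrDl -mulrA lerD// ler_wpM2l// rnorm_ge0.
move=> x wx; have := sS _ wx; have := sT _ wx => Tx Sx.
apply: (@le_lt_trans _ _ (\sum_(0 <= n <oo) ((rnorm (a : K^o))%:E * (rnorm (S (x n)))%:E
    + (rnorm (T (x n)))%:E))%E).
  by apply: lee_nneseries => n _; rewrite ?lee_fin ?rnorm_ge0.
rewrite nneseriesD; last 2 first.
- by move=> n _ _; rewrite -EFinM lee_fin mulr_ge0 ?rnorm_ge0.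
- by move=> n _ _; rewrite lee_fin rnorm_ge0.
rewrite nneseriesZl; last by move=> n _; rewrite lee_fin rnorm_ge0.
rewrite lte_add_pinfty// lte_mul_pinfty// lee_fin rnorm_ge0//.
Qed.

HB.instance Definition _ :=
  GRing.isSubmodClosed.Build K (E -> F) Pi1_pred Pi1_submod_closed.
HB.instance Definition _ := [SubChoice_isSubLmodule of Pi1 by <:].

Lemma Pi1_summing (T : Pi1) : absolutely_summing T.
Proof. by case: T => T /= /asboolP. Qed.

Fact Pi1_normD (S T : Pi1) : ofR (pi1 (S + T)) <= ofR (pi1 S) + ofR (pi1 T) :> K.
Proof.
have sS := Pi1_summing S; have sT := Pi1_summing T.
rewrite -ofRD ler_ofR; apply: pi1_le => [|n x].
  by rewrite addr_ge0// pi1_ge0.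
rewrite mulrDl (le_trans _ (lerD (pi1P x sS) (pi1P x sT)))//.
by rewrite -big_split/=; apply: ler_sum => i _; exact: ler_rnormD.
Qed.

Fact Pi1_normZ (a : K) (T : Pi1) : ofR (pi1 (a *: T)) = `|a| * ofR (pi1 T) :> K.
Proof.
have sT := Pi1_summing T; have saT := Pi1_summing (a *: T).
rewrite -(ofR_rnorm (a : K^o)) -ofRM; congr ofR; apply/eqP; rewrite eq_le.
apply/andP; split.
  apply: pi1_le => [|n x]; first by rewrite mulr_ge0 ?pi1_ge0 ?rnorm_ge0.
  under eq_bigr do rewrite /= rnormZ.
  by rewrite -mulr_sumr -mulrA ler_wpM2l ?rnorm_ge0// pi1P.
have [->|a0] := eqVneq (rnorm (a : K^o)) 0; first by rewrite mul0r pi1_ge0.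
have ap : 0 < rnorm (a : K^o) by rewrite lt_neqAle eq_sym a0 rnorm_ge0.
rewrite -ler_pdivlMl//; apply: pi1_le => [|n x].
  by rewrite mulr_ge0 ?pi1_ge0 ?invr_ge0 ?rnorm_ge0.
rewrite -mulrA ler_pdivlMl// mulr_sumr.
by under eq_bigr do rewrite -rnormZ; exact: (pi1P x saT).
Qed.

Fact Pi1_norm0_eq0 (T : Pi1) : ofR (pi1 T) = 0 :> K -> T = 0.
Proof.
rewrite -[X in _ = X]ofR0 => /(can_inj ofRK) T0; apply/val_inj/funext => x /=.
apply/rnorm0_eq0/eqP; rewrite eq_le rnorm_ge0 andbT.
by have := le_pi1 x (Pi1_summing T); rewrite T0 mul0r.
Qed.

HB.instance Definition _ :=
  @Lmodule_isNormed.Build K Pi1 (fun T => ofR (pi1 T))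
    Pi1_normD Pi1_normZ Pi1_norm0_eq0.

End Pi1.

Section complemented.
Context {R : realType} {k : scalar_kind}.
Local Notation K := (scalars R k).

Definition closed_subspace (V : normedModType K) (M : set V) : Prop :=
  closed M /\ submod_closed (mem M).

(* The space U is linearly homeomorphic to the subspace M of V. *)
Definition linearly_homeomorphic (U V : normedModType K) (M : set V) : Prop :=
  exists (J : U -> V) (G : V -> U),
    [/\ linear J, continuous J, range J = M, cancel J G &
        {within M, continuous G}].

Definition complemented (V : normedModType K) (M : set V) : Prop :=
  exists P : V -> V,
    [/\ bounded_linear P, (forall x, P (P x) = P x) & range P = M].

Definition has_complemented_c0 (V : normedModType K) : Prop :=
  exists M : set V,
    [/\ closed_subspace M, linearly_homeomorphic (c0 R k) M & complemented M].

End complemented.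

(* Main.v *)
Require Import Defs.
From mathcomp Require Import all_boot all_order all_algebra.
From mathcomp Require Import all_classical all_reals all_analysis.
From mathcomp Require Import complex ring.
From HB Require Import structures.
Import numFieldNormedType.Exports.
Local Open Scope ring_scope.
Import Order.TTheory GRing.Theory Num.Theory.
Local Open Scope classical_set_scope.

(** The space F is a retract of Pi_1(E,F) in the category of bounded linear
maps.  Since E is nonzero, the Hahn-Banach theorem gives x0 in E and a bounded
functional f with f(x0) = 1 ([dual_normalized]).  The rank-one operators
f(.)y are absolutely summing and depend boundedly and linearly on y
([rank_one_bounded_linear]), evaluation at x0 is bounded from Pi_1(E,F) to F
([evaluation_bounded_linear]), and evaluating f(.)y at x0 gives back y.

A complemented copy of c_0 passes from a retract to the whole space
([has_complemented_c0_retract]): if i : V -> W has left inverse q and P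
projects V onto a copy M of c_0, then i o P o q projects W onto i(M), and
q restricted to i(M) inverts i.

The Hahn-Banach theorem is obtained without extending partial functionals,
from sublinear functionals alone.  Zorn's lemma gives a minimal sublinear q
below a given p.  For every vector a there is a sublinear functional below q
whose value at -a is at most -q(a) ([lower_sublinear]); by minimality q itself
satisfies this, so q is odd, hence linear.  Complex scalars are reduced to real
ones by taking the complex functional with prescribed real part. *)

(** * Sublinear functionals and the Hahn-Banach theorem *)

Section Sublinear.
Context {R : realType} {V : lmodType R}.
Implicit Types (p q : V -> R) (a x y : V).

(** Asking for one inequality of homogeneity is enough ([sublinearZ]), and it is
the form in which infima inherit the property. *)
Definition sublinear q : Prop :=
  (forall x y, q (x + y) <= q x + q y) /\
  (forall r x, 0 <= r -> q (r *: x) <= r * q x).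

Lemma sublinear0 q : sublinear q -> q 0 = 0.
Proof.
move=> [qD qZ]; apply/eqP; rewrite eq_le; apply/andP; split.
  by have := qZ 0 0 (lexx _); rewrite scale0r mul0r.
by have := qD 0 0; rewrite addr0 lerDl.
Qed.

Lemma sublinearZ q r x : sublinear q -> 0 <= r -> q (r *: x) = r * q x.
Proof.
move=> sq; rewrite le_eqVlt => /predU1P[<-|r0].
  by rewrite scale0r mul0r sublinear0.
apply/eqP; rewrite eq_le (sq.2 _ _ (ltW r0)) -ler_pdivlMl//=.
have := sq.2 r^-1 (r *: x); rewrite scalerA mulVf ?gt_eqF// scale1r; apply.
by rewrite invr_ge0 ltW.
Qed.

Lemma sublinear_geN q x : sublinear q -> - q (- x) <= q x.
Proof.
by move=> sq; rewrite lerNl -subr_ge0 opprK -(sublinear0 _ sq) -(addNr x) sq.1.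
Qed.

(** The pointwise infimum of a family is sublinear as soon as each inequality
may be met by some other member of the family.  Chains of sublinear functionals
meet the first condition because of any two members one is the smaller; the
family of [lower_sublinear] meets both by moving its parameter. *)
Lemma inf_sublinear {I : Type} (D : set I) (G : I -> V -> R) :
  D !=set0 -> (forall x, has_lbound [set G i x | i in D]) ->
  (forall i j x y, D i -> D j -> exists2 l, D l & G l (x + y) <= G i x + G j y) ->
  (forall i r x, D i -> 0 <= r -> exists2 l, D l & G l (r *: x) <= r * G i x) ->
  sublinear (fun x => inf [set G i x | i in D]).
Proof.
move=> [i0 Di0] lbG GD GZ.
have infle i x : D i -> inf [set G i x | i in D] <= G i x.
  by move=> Di; apply: ge_inf => //; exists i.
have leinf x (c : R) : (forall i, D i -> c <= G i x) ->
    c <= inf [set G i x | i in D].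
  move=> cG; apply: lb_le_inf; first by exists (G i0 x), i0.
  by move=> _ [i Di <-]; exact: cG.
split=> /= [x y|r x].
  rewrite -lerBlDl; apply: (leinf _ _) => j Dj; rewrite lerBlDl -lerBlDr.
  apply: (leinf _ _) => i Di; rewrite lerBlDr.
  have [l Dl Gl] := GD i j x y Di Dj.
  exact: le_trans (infle _ _ Dl) Gl.
(* At r = 0 the claim is inf 0 <= 0; for r > 0 one divides by r. *)
rewrite le_eqVlt => /predU1P[<-|r0].
  rewrite mul0r; have [l Dl Gl] := GZ i0 0 x Di0 (lexx _).
  by rewrite mul0r in Gl; exact: le_trans (infle _ _ Dl) Gl.
rewrite -ler_pdivrMl//; apply: (leinf _ _) => i Di; rewrite ler_pdivrMl//.
have [l Dl Gl] := GZ i r x Di (ltW r0).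
exact: le_trans (infle _ _ Dl) Gl.
Qed.

(** Zorn's lemma for the reversed pointwise order.  The infimum of a chain is
finite because a sublinear q below p satisfies q(x) >= - q(- x) >= - p(- x). *)
Lemma minimal_sublinear p : sublinear p ->
  exists q, [/\ sublinear q, forall x, q x <= p x &
    forall q', sublinear q' -> (forall x, q' x <= q x) -> forall x, q x <= q' x].
Proof.
move=> sp; pose T := {q : V -> R | sublinear q /\ forall x, q x <= p x}.
pose below : rel T := fun q q' : T => `[< forall x, sval q' x <= sval q x >].
have Tp : sublinear p /\ forall x, p x <= p x by [].
have [|||[q [sq qp]] qmin] := @ZL_preorder T (exist _ p Tp) below.
- by move=> q; apply/asboolP.
- move=> q1 q2 q3 /asboolP q12 /asboolP q23; apply/asboolP => x.
  exact: le_trans (q23 x) (q12 x).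
- move=> A Atot; have [->|/set0P[q0 Aq0]] := eqVneq A set0.
    by exists (exist _ p Tp).
  have lbA x : has_lbound [set sval q x | q in A].
    exists (- p (- x)) => _ [q _ <-]; have [sq qp] := svalP q.
    by rewrite (le_trans _ (sublinear_geN _ x sq))// lerN2.
  pose m x := inf [set sval q x | q in A].
  have mle (q : T) x : A q -> m x <= sval q x.
    by move=> Aq; apply: ge_inf => //; exists q.
  have sm : sublinear m.
    apply: inf_sublinear; [by exists q0|by []| |].
    + move=> q1 q2 x y Aq1 Aq2.
      have [/asboolP le12|/asboolP le21] := Atot _ _ Aq1 Aq2.
      * exists q2 => //; rewrite (le_trans ((svalP q2).1.1 x y))//.
        by rewrite lerD.
      * exists q1 => //; rewrite (le_trans ((svalP q1).1.1 x y))//.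
        by rewrite lerD.
    + move=> q r x Aq r0; exists q => //; exact: (svalP q).1.2.
  have Tm : sublinear m /\ forall x, m x <= p x.
    split=> // x; exact: le_trans (mle _ x Aq0) ((svalP q0).2 x).
  by exists (exist _ m Tm) => q Aq; apply/asboolP => x; exact: mle.
- exists q; split=> [//|//|] q' sq' q'q.
  have Tq' : sublinear q' /\ forall x, q' x <= p x.
    by split=> // x; exact: le_trans (q'q x) (qp x).
  have /(qmin (exist _ q' Tq'))/asboolP// :
      below (exist _ q (conj sq qp)) (exist _ q' Tq').
  by apply/asboolP.
Qed.

(** The witness is q'(x) = inf_(t >= 0) (q(x + t a) - t q(a)): the parameter
t = 0 shows that it lies below q, and t = 1 gives the value at - a.  For a
minimal q it forces q(- a) = - q(a); applied once to p before minimizing, it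
makes the resulting functional agree with p at a. *)
Lemma lower_sublinear q a : sublinear q ->
  exists q', [/\ sublinear q', forall x, q' x <= q x & q' (- a) <= - q a].
Proof.
move=> sq; pose G (t : R) x := q (x + t *: a) - t * q a.
pose D := [set t : R | 0 <= t].
have lbG x : has_lbound [set G t x | t in D].
  exists (- q (- x)) => _ [t t0 <-]; rewrite /G lerNl opprB lerBlDr.
  by rewrite -(sublinearZ _ _ a sq t0) (le_trans _ (sq.1 _ _))// addKr.
have le_inf t x : D t -> inf [set G t x | t in D] <= G t x.
  by move=> Dt; apply: ge_inf => //; exists t.
exists (fun x => inf [set G t x | t in D]); split.
- apply: inf_sublinear => //; first by exists 0; rewrite /D/=.
  + move=> s t x y s0 t0; exists (s + t); first exact: addr_ge0.
    rewrite /G scalerDl mulrDl addrACA opprD.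
    rewrite [leRHS]addrACA lerD2r; exact: sq.1.
  + move=> t r x t0 r0; exists (r * t); first exact: mulr_ge0.
    by rewrite /G -scalerA -scalerDr mulrBr mulrA lerD// sq.2.
- move=> x; apply: le_trans (le_inf 0 x (lexx _)) _.
  by rewrite /G scale0r mul0r subr0 addr0.
- apply: le_trans (le_inf 1 _ ler01) _.
  by rewrite /G scale1r mul1r addNr sublinear0// sub0r.
Qed.

Lemma odd_sublinear_linear q : sublinear q -> (forall x, q (- x) = - q x) ->
  linear (q : V -> R^o).
Proof.
move=> sq qN r x y.
have qD u v : q (u + v) = q u + q v.
  apply/eqP; rewrite eq_le sq.1 /=.
  by rewrite -lerN2 opprD -!qN opprD sq.1.
rewrite qD; congr (_ + _).
have [r0|/ltW r0] := leP 0 r; first exact: sublinearZ.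
rewrite -[in LHS](opprK r) scaleNr qN sublinearZ ?oppr_ge0//.
by rewrite mulNr opprK.
Qed.

(** Minimizing below a functional p' <= p with p'(- x0) <= - p(x0) gives
f(- x0) <= - p(x0), and oddness turns this into f(x0) >= p(x0). *)
Theorem hahn_banach_sublinear p x0 : sublinear p ->
  exists f : V -> R^o, [/\ linear f, forall x, f x <= p x & f x0 = p x0].
Proof.
move=> sp; have [p' [sp' p'p p'x0]] := lower_sublinear p x0 sp.
have [q [sq qp' qmin]] := minimal_sublinear p' sp'.
have qN x : q (- x) = - q x.
  apply/eqP; rewrite eq_le [X in _ && X]lerNl.
  have [q' [sq' q'q q'x]] := lower_sublinear q x sq.
  rewrite (le_trans (qmin q' sq' q'q _) q'x)/=.
  exact: sublinear_geN.
have qp x : q x <= p x by exact: le_trans (qp' x) (p'p x).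
exists q; split=> //; first exact: odd_sublinear_linear.
apply/eqP; rewrite eq_le qp /= -lerN2 -qN.
exact: le_trans (qp' _) p'x0.
Qed.

End Sublinear.

(** * Functionals on real and complex normed spaces *)

(** The space E with its scalars restricted to the reals along [ofR], so that the
real Hahn-Banach theorem applies to both kinds of scalars at once. *)
Definition realified {R : realType} {k : scalar_kind}
  (E : normedModType (scalars R k)) : Type := E.

Section Realified.
Context {R : realType} {k : scalar_kind} (E : normedModType (scalars R k)).

HB.instance Definition _ := GRing.Zmodule.on (realified E).

Fact realified_scalerA (r s : R) (x : realified E) :
  (ofR r : scalars R k) *: ((ofR s : scalars R k) *: (x : E)) =
  (ofR (r * s) : scalars R k) *: (x : E).
Proof. by rewrite scalerA ofRM. Qed.

Fact realified_scale1r (x : realified E) :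
  (ofR 1 : scalars R k) *: (x : E) = x.
Proof. by rewrite ofR1 scale1r. Qed.

Fact realified_scalerDr (r : R) (x y : realified E) :
  (ofR r : scalars R k) *: (x + y : E) =
  (ofR r : scalars R k) *: (x : E) + (ofR r : scalars R k) *: (y : E).
Proof. exact: scalerDr. Qed.

Fact realified_scalerDl (x : realified E) (r s : R) :
  (ofR (r + s) : scalars R k) *: (x : E) =
  (ofR r : scalars R k) *: (x : E) + (ofR s : scalars R k) *: (x : E).
Proof. by rewrite ofRD scalerDl. Qed.

HB.instance Definition _ := GRing.Zmodule_isLmodule.Build R (realified E)
  realified_scalerA realified_scale1r realified_scalerDr realified_scalerDl.

Lemma realified_scaleE (r : R) (x : realified E) :
  r *: x = (ofR r : scalars R k) *: (x : E).
Proof. by []. Qed.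

Lemma rnorm_sublinear : sublinear (rnorm : realified E -> R).
Proof.
split=> [x y|r x r0]; first exact: ler_rnormD.
by rewrite realified_scaleE rnormZ rnorm_ofR.
Qed.

Lemma real_norming_functional (x0 : E) :
  exists u : realified E -> R^o, [/\ linear u,
    forall x : E, `|u x| <= rnorm x & u x0 = rnorm x0].
Proof.
have [u [lu un ux0]] := hahn_banach_sublinear _ (x0 : realified E) rnorm_sublinear.
exists u; split=> // x; rewrite ler_norml un andbT lerNl.
have -> : - u x = u (- x).
  have u0 : u 0 = 0.
    have := lu 1 0 0; rewrite !scale1r addr0 => /eqP.
    by rewrite -subr_eq subrr eq_sym => /eqP.
  by have := lu (-1) x 0; rewrite !scaleN1r !addr0 u0 addr0 => ->.
rewrite (le_trans (un _))// /rnorm.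
by rewrite (normrN (x : E)).
Qed.

End Realified.

Section Complexify.
Context {R : realType} (E : normedModType (scalars R ComplexScalars)).

Let icx : scalars R ComplexScalars := 'i%C.

(** A complex-linear g is determined by its real part u, since the imaginary part
of g(x) is - u(i x). *)
Definition complexified (u : realified E -> R^o) (x : E) :
  (scalars R ComplexScalars)^o := (Complex (u x) (- u (icx *: x)) : R[i]).

Lemma complexified_linear u : linear u -> linear (complexified u).
Proof.
move=> lu.
have uD x y : u (x + y) = u x + u y by have := lu 1 x y; rewrite !scale1r.
have u0 : u 0 = 0 by apply: (addrI (u 0)); rewrite -uD !addr0.
have uZ (r : R) (x : E) : u ((ofR r : scalars R ComplexScalars) *: x) = r * u x.
  by have := lu r x 0; rewrite !addr0 u0 addr0.
move=> [a b] x y.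
have zE : (Complex a b : scalars R ComplexScalars) = ofR a + ofR b * icx.
  by rewrite /= /icx; simpc.
have iE : icx * (Complex a b : scalars R ComplexScalars) = ofR (- b) + ofR a * icx.
  by rewrite /= /icx; simpc.
have uzx : u ((Complex a b : scalars R ComplexScalars) *: x) =
    a * u x + b * u (icx *: x).
  by rewrite zE scalerDl uD -scalerA !uZ.
have uiz : u (icx *: ((Complex a b : scalars R ComplexScalars) *: x)) =
    a * u (icx *: x) - b * u x.
  by rewrite scalerA iE scalerDl uD -scalerA !uZ addrC mulNr.
rewrite /complexified scalerDr !uD uzx uiz.
apply/eqP; rewrite eq_complex /=; apply/andP; split; apply/eqP;
  move: (u x) (u y) (u (icx *: x)) (u (icx *: y)) => p q r t.
- change (a * p + b * r + q = a * p - b * - r + q :> R). ring.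
- change (- (a * r - b * p + t) = a * - r + b * p - t :> R). ring.
Qed.

Lemma rnorm_complex_le (a b : R) :
  rnorm (Complex a b : (scalars R ComplexScalars)^o) <= `|a| + `|b|.
Proof.
change (Num.sqrt (a ^+ 2 + b ^+ 2) <= `|a| + `|b|).
rewrite -[leRHS]ger0_norm ?addr_ge0// -sqrtr_sqr ler_wsqrtr//.
rewrite sqrrD !real_normK ?num_real//.
by rewrite lerD2r lerDl mulrn_wge0// mulr_ge0.
Qed.

(** The constant 2 (the sharp one is 1) comes from bounding the modulus by
|u(x)| + |u(i x)|, where |i x| = |x|. *)
Lemma complexified_bound u : (forall x : E, `|u x| <= rnorm x) ->
  forall x, rnorm (complexified u x) <= 2 * rnorm x.
Proof.
move=> un x; rewrite (le_trans (rnorm_complex_le _ _))// normrN.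
have icx1 : rnorm (icx : (scalars R ComplexScalars)^o) = 1.
  by change (Num.sqrt (0 ^+ 2 + 1 ^+ 2) = 1 :> R);
    rewrite expr0n expr1n add0r sqrtr1.
have -> : 2 * rnorm x = rnorm x + rnorm (icx *: x).
  by rewrite rnormZ icx1 mul1r mulr_natl mulr2n.
by rewrite lerD.
Qed.

End Complexify.

(** Hahn-Banach supplies a bounded g with g(x0) != 0, and f = g / g(x0). *)
Lemma dual_normalized (R : realType) (k : scalar_kind)
    (E : normedModType (scalars R k)) (x0 : E) : x0 != 0 ->
  exists f : E -> (scalars R k)^o, dual f /\ f x0 = 1.
Proof.
move=> x00.
suff [g [dg gx0]] : exists g : E -> (scalars R k)^o, dual g /\ g x0 != 0.
  exists (fun x => (g x0)^-1 *: g x); split; last by rewrite /GRing.scale /= mulVf.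
  split.
    move=> a x y; rewrite dg.1 scalerDr !scalerA; congr (_ *: _ + _).
    by rewrite mulrC.
  have [M gM] := dg.2; exists (rnorm ((g x0)^-1 : (scalars R k)^o) * M) => x.
  by rewrite rnormZ -mulrA ler_wpM2l// rnorm_ge0.
have nx0 : rnorm x0 != 0 by apply: contra_neq x00; exact: rnorm0_eq0.
have [u [lu un ux0]] := real_norming_functional E x0.
destruct k.
  exists u; split; last by rewrite ux0.
  by split => //; exists 1 => x; rewrite mul1r; exact: un.
exists (complexified E u); split.
  split; first exact: complexified_linear.
  by exists 2; exact: complexified_bound.
by rewrite eq_complex /= ux0 negb_and nx0.
Qed.

(** * Complemented copies of c_0 and retracts *)

Section BoundedLinear.
Context {R : realType} {k : scalar_kind}.
Implicit Types U V W : normedModType (scalars R k).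

Lemma linear_sub U V (T : U -> V) x y : linear T -> T (x - y) = T x - T y.
Proof. by move=> lT; rewrite addrC -scaleN1r lT scaleN1r addrC. Qed.

Lemma continuous_bounded_linear U V (T : U -> V) :
  bounded_linear T -> continuous T.
Proof.
move=> bT; have [M M0 TM] := bounded_linear_pos bT.
have M0' : 0 < (ofR M : scalars R k).
  by rewrite -ofR0 lt_neqAle ler_ofR ltW// andbT (can_eq ofRK) lt_eqF.
move=> x; apply/cvgrPdist_lt => e e0.
near=> y; rewrite -(linear_sub _ _ _ _ _ bT.1).
have Txy : `|T (x - y)| <= ofR M * `|x - y| by rewrite -!ofR_rnorm -ofRM ler_ofR.
rewrite (le_lt_trans Txy)// -ltr_pdivlMl// mulrC.
near: y; apply: cvgr_dist_lt => //; exact: divr_gt0.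
Unshelve. all: by end_near. Qed.

Lemma bounded_linear_comp U V W (S : V -> W) (T : U -> V) :
  bounded_linear S -> bounded_linear T -> bounded_linear (S \o T).
Proof.
move=> bS bT; split; first by move=> a x y; rewrite /= bT.1 bS.1.
have [M M0 SM] := bounded_linear_pos bS; have [N N0 TN] := bounded_linear_pos bT.
exists (M * N) => x; rewrite (le_trans (SM _))// -mulrA.
by apply: ler_wpM2l; [exact: ltW|exact: TN].
Qed.

(** The range of a projection P is its set of fixed points, that is, the kernel of
the continuous map P - id. *)
Lemma closed_range_projection V (P : V -> V) :
  bounded_linear P -> (forall x, P (P x) = P x) -> closed_subspace (range P).
Proof.
move=> bP PP.
have PE x : range P x <-> P x = x by split=> [[y _ <-]|<-]; [|exists x].
have P0 := Defs.linear0 bP.1.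
split; last first.
  split; first by apply/mem_set; exists 0.
  move=> a x y /set_mem/PE Px /set_mem/PE Py; apply/mem_set/PE.
  by rewrite bP.1 Px Py.
have -> : range P = (fun x => P x - x) @^-1` [set 0].
  apply/seteqP; split=> x /=; first by move=> /PE ->; rewrite subrr.
  by move=> /subr0_eq/PE.
apply: closed_comp; last first.
  exact: accessible_closed_set1 (hausdorff_accessible (@norm_hausdorff _ _)) _.
move=> x _; apply: cvgB; last exact: cvg_id.
exact: continuous_bounded_linear.
Qed.

(** The image i(M) is closed because it is the range of the projection
i o P o q. *)
Lemma has_complemented_c0_retract V W (i : V -> W) (q : W -> V) :
  bounded_linear i -> bounded_linear q -> cancel i q ->
  has_complemented_c0 V -> has_complemented_c0 W.
Proof.
move=> bi bq iK [M [_ [J [G [lJ cJ rJ JK cG]]] [P [bP PP rP]]]].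
pose P' := i \o P \o q.
have bP' : bounded_linear P'.
  by apply: bounded_linear_comp => //; exact: bounded_linear_comp.
have P'P' x : P' (P' x) = P' x by rewrite /P' /= iK PP.
have rP' : range P' = i @` M.
  rewrite -rP; apply/seteqP; split=> [_ [x _ <-]|_ [_ [y _ <-] <-]].
    by exists (P (q x)) => //; exists (q x).
  by exists (i y) => //; rewrite /P' /= iK.
exists (i @` M); split; last by exists P'.
  by rewrite -rP'; exact: closed_range_projection.
exists (i \o J), (G \o q); split.
- by move=> a x y; rewrite /= lJ bi.1.
- by move=> x; apply: continuous_comp; [exact: cJ|exact: continuous_bounded_linear].
- rewrite -rJ; apply/seteqP.
  split=> [_ [u _ <-]|_ [_ [u _ <-] <-]]; last by exists u.
  by exists (J u) => //; exists u.
- by move=> x; rewrite /= iK.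
apply/subspace_continuousP => _ [y My <-] B.
(* Unfolds the subspace topology into neighbourhoods in W. *)
change (nbhs (G (q (i y))) B -> nbhs (i y) [set x | (i @` M) x -> B (G (q x))]).
rewrite iK => GB.
(* The map q is continuous and sends i(M) into M, where G is continuous. *)
have GM : nbhs (q (i y)) [set z | M z -> B (G z)].
  by rewrite iK; exact: (iffLR (subspace_continuousP _ _) cG y My B GB).
have qM : nbhs (i y) (q @^-1` [set z | M z -> B (G z)]).
  exact: (continuous_bounded_linear _ _ _ bq (i y) _ GM).
apply: filterS qM => x /= + [z Mz zx].
by rewrite -zx iK; apply.
Qed.

End BoundedLinear.

(** * Rank-one operators *)

Section RankOne.
Context {R : realType} {k : scalar_kind} {E F : normedModType (scalars R k)}.
Context {f : E -> (scalars R k)^o} (df : dual f).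

Lemma rank_one_summing (y : F) : absolutely_summing (fun x => f x *: y).
Proof.
split.
  split; first by move=> a u v; rewrite df.1 scalerDl scalerA.
  have [M _ fM] := bounded_linear_pos df.
  exists (M * rnorm y) => x; rewrite rnormZ mulrAC ler_wpM2r ?rnorm_ge0//.
move=> x /(_ f df) fx.
under eq_eseriesr do rewrite rnormZ mulrC EFinM.
rewrite nneseriesZl; last by move=> n _; rewrite lee_fin rnorm_ge0.
by rewrite lte_mul_pinfty// lee_fin rnorm_ge0.
Qed.

Definition rank_one (y : F) : Pi1 E F :=
  MkPi1 (asboolT (rank_one_summing y)).

(** With M bounding the 1-summing norm of f, the operator f(.)y satisfies
sum |f(x_i)| |y| <= M |y| weak_norm(x), so its 1-summing norm is at most
M |y|. *)
Lemma rank_one_bounded_linear : bounded_linear rank_one.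
Proof.
split.
  move=> a y z; apply/val_inj/funext => x /=.
  by rewrite !fctE scalerDr !scalerA mulrC.
have [M M0 fM] := dual_weak_norm df; exists M => y.
rewrite /rnorm ofRK /=.
apply: pi1_le => [|n x]; first by rewrite mulr_ge0 ?rnorm_ge0// ltW.
under eq_bigr do rewrite /= rnormZ.
by rewrite -mulr_suml mulrAC ler_wpM2r ?rnorm_ge0.
Qed.

End RankOne.

Lemma evaluation_bounded_linear {R : realType} {k : scalar_kind}
    {E F : normedModType (scalars R k)} (x : E) :
  bounded_linear (fun T : Pi1 E F => T x).
Proof.
split=> //; exists (rnorm x) => T.
rewrite mulrC [rnorm T]ofRK; exact/le_pi1/Pi1_summing.
Qed.

Theorem theorem6 (R : realType) (k : scalar_kind)
    (E F : completeNormedModType (scalars R k)) :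
  (exists x : E, x != 0) ->
  has_complemented_c0 F -> has_complemented_c0 (Pi1 E F).
Proof.
move=> [x0 /dual_normalized[f [df fx0]]].
apply: has_complemented_c0_retract (rank_one_bounded_linear df)
  (evaluation_bounded_linear x0) _.
by move=> y; rewrite /= fx0 scale1r.
Qed.
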